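(* Let $\mathbb{K}$ be a field and for each partition diagram $\pi$ let $L_\pi:=\sum_{\sigma\le\pi}M_\sigma\in\mathrm{ParQSym}$. Then for every partition diagram $\pi$, $$\Delta L_\pi=\sum_{\rho\otimes\sigma=\pi\ \text{or}\ \rho\bullet\sigma=\pi}L_\rho\otimes L_\sigma,$$ where the sum is over all ordered pairs $(\rho,\sigma)$ of (possibly empty) partition diagrams such that $\rho\otimes\sigma=\pi$ or $\rho\bullet\sigma=\pi$, each pair being counted once.
   Context: **Partition diagrams.** A partition diagram of order $k\ge 0$ is a set partition of $\{1,\dots,k,1',\dots,k'\}$; for $k=0$ the only one is the empty diagram $\emptyset$. For $\pi$ of order $k$ and $\rho$ of order $m$, $\pi\otimes\rho$ is the diagram of order $k+m$ whose blocks are the blocks of $\pi$ and the blocks of $\rho$ with labels shifted by $k$ ($i\mapsto i+k$, $i'\mapsto (i+k)'$). If $k,m\ge1$, $\pi\bullet\rho$ is obtained from $\pi\otimes\rho$ by merging the block containing $k'$ with the block containing $(k+1)'$. The empty diagram is the unit for both operations. A diagram is $\otimes$-irreducible (resp. $\bullet$-irreducible) if it is not $\rho\otimes\sigma$ (resp. $\rho\bullet\sigma$) with $\rho,\sigma$ both non-empty. **Refinement.** Every non-empty $\pi$ can be uniquely written $\pi=\pi_1\divideontimes_1\pi_2\divideontimes_2\cdots\divideontimes_{n-1}\pi_n$ with each $\divideontimes_i\in\{\otimes,\bullet\}$ and each $\pi_i$ non-empty and both $\otimes$- and $\bullet$-irreducible (on non-empty diagrams $\otimes$ and $\bullet$ associate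 with each other, so no brackets are needed). Put $S(\pi)=\{i\in\{1,\dots,n-1\}:\divideontimes_i=\otimes\}$. For non-empty $\pi,\sigma$ write $\pi\sim\sigma$ if their sequences $(\pi_1,\dots,\pi_n)$ and $(\sigma_1,\dots,\sigma_m)$ are equal; $\pi\le\sigma$ ($\pi$ refines $\sigma$) if $\pi\sim\sigma$ and $S(\sigma)\subseteq S(\pi)$. The empty diagram is related only to itself, with $\emptyset\le\emptyset$. **Coalgebra ParQSym.** $\mathrm{ParQSym}$ is the $\mathbb{K}$-vector space with basis $\{M_\pi\}$ indexed by all partition diagrams, with coproduct $\Delta M_\sigma=\sum_{\pi\otimes\rho=\sigma}M_\pi\otimes M_\rho$ over all ordered pairs of (possibly empty) diagrams with $\pi\otimes\rho=\sigma$. *)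

(* Defs.v *)
From HB Require Import structures.
From mathcomp Require Import all_boot all_order all_algebra.
From mathcomp Require Import finmap boolp monalg.

Set Implicit Arguments.
Unset Strict Implicit.
Unset Printing Implicit Defensive.

Import GRing.Theory.
Local Open Scope ring_scope.

(* The label i of {1, ..., k} is [inl] of the ordinal i - 1, and the label i'  *)
(* is [inr] of the ordinal i - 1.                                              *)
Definition label (k : nat) : finType := ('I_k + 'I_k)%type.

Definition setpart (k : nat) : finType :=
  {P : {set {set label k}} | partition P [set: label k]}.

Definition SetPart k (P : {set {set label k}}) (pP : partition P [set: label k]) :
  setpart k := exist (fun P => is_true (partition P [set: label k])) P pP.

Definition diagram : choiceType := {k : nat & setpart k}.

Definition Diagram k (P : setpart k) : diagram := Tagged setpart P.

Definition dorder (d : diagram) : nat := tag d.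

Section SetPartitions.
Variable T : finType.

Lemma partition_setTI (P : {set {set T}}) :
  (forall x, exists2 A, A \in P & x \in A) ->
  (forall A B x, A \in P -> B \in P -> x \in A -> x \in B -> A = B) ->
  set0 \notin P -> partition P [set: T].
Proof.
move=> cP tP P0; apply/and3P; split=> //.
  apply/eqP/setP=> x; rewrite inE.
  by have [A AP xA] := cP x; apply/bigcupP; exists A.
apply/trivIsetP=> A B AP BP; apply: contraNT => /pred0Pn[x /andP[xA xB]].
by apply/eqP; apply: tP xA xB.
Qed.

Lemma partition_setT_cover (P : {set {set T}}) x :
  partition P [set: T] -> exists2 A, A \in P & x \in A.
Proof.
by move/cover_partition/setP/(_ x); rewrite inE => /bigcupP[A ? ?]; exists A.
Qed.

Lemma partition_setT_eq (P : {set {set T}}) A B x :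
  partition P [set: T] -> A \in P -> B \in P -> x \in A -> x \in B -> A = B.
Proof.
move=> /partition_trivIset tP AP BP xA xB.
by rewrite -(def_pblock tP AP xA) (def_pblock tP BP xB).
Qed.

Definition merge_blocks (P : {set {set T}}) (x y : T) : {set {set T}} :=
  (pblock P x :|: pblock P y) |: (P :\: [set pblock P x; pblock P y]).

Lemma merge_blocksP (P : {set {set T}}) x y :
  partition P [set: T] -> partition (merge_blocks P x y) [set: T].
Proof.
move=> pP; have tP := partition_trivIset pP.
have cP z : z \in cover P by rewrite (cover_partition pP) inE.
have key A z : A \in P :\: [set pblock P x; pblock P y] ->
    z \in A -> z \in pblock P x :|: pblock P y -> False.
  rewrite !inE negb_or => /andP[/andP[/eqP nx /eqP ny] AP] zA /orP[] zB.
    by apply: nx; apply: (partition_setT_eq pP AP _ zA zB); rewrite pblock_mem.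
  by apply: ny; apply: (partition_setT_eq pP AP _ zA zB); rewrite pblock_mem.
apply: partition_setTI => [z|A B z|].
- have [A AP zA] := partition_setT_cover z pP.
  have [Axy|nAxy] := boolP (A \in [set pblock P x; pblock P y]).
    exists (pblock P x :|: pblock P y); first exact: setU11.
    by move: Axy; rewrite !inE => /orP[]/eqP <-; rewrite zA ?orbT.
  by exists A => //; rewrite /merge_blocks in_setU1 in_setD nAxy AP orbT.
- rewrite !in_setU1 => /orP[/eqP->|AP] /orP[/eqP->|BP] // zA zB.
  + by case: (key B z).
  + by case: (key A z).
  + move: AP BP; rewrite !in_setD => /andP[_ AP] /andP[_ BP].
    exact: partition_setT_eq pP AP BP zA zB.
- rewrite in_setU1 in_setD (partition0 pP) andbF orbF eq_sym.
  by apply/set0Pn; exists x; rewrite inE mem_pblock cP.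
Qed.

End SetPartitions.

Definition labelL k m (x : label k) : label (k + m) :=
  match x with inl i => inl (lshift m i) | inr i => inr (lshift m i) end.

Definition labelR k m (x : label m) : label (k + m) :=
  match x with inl i => inl (rshift k i) | inr i => inr (rshift k i) end.

Lemma labelL_inj k m : injective (@labelL k m).
Proof. by move=> [i|i] [j|j] //= [] /val_inj ->. Qed.

Lemma labelR_inj k m : injective (@labelR k m).
Proof. by move=> [i|i] [j|j] //= [] /addnI/val_inj ->. Qed.

Lemma labelLR k m x y : @labelL k m x <> @labelR k m y.
Proof.
by case: x y => i [j|j] //= [] eq_ij; have:= ltn_ord i; rewrite eq_ij ltnNge leq_addr.
Qed.

Variant label_spec k m : label (k + m) -> Prop :=
  | LabelL x : label_spec (labelL m x)
  | LabelR y : label_spec (labelR k y).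

Lemma labelP k m (z : label (k + m)) : label_spec z.
Proof.
case: z => i; rewrite -[i]splitK; case: (split i) => j /=.
- exact: (LabelL m (inl j)).
- exact: (LabelR k (inl j)).
- exact: (LabelL m (inr j)).
- exact: (LabelR k (inr j)).
Qed.

Definition tens_blocks k m (P : {set {set label k}}) (Q : {set {set label m}}) :
    {set {set label (k + m)}} :=
  [set (@labelL k m) @: (B : {set label k}) | B in P]
    :|: [set (@labelR k m) @: (B : {set label m}) | B in Q].

Lemma tens_blocksP k m (P : setpart k) (Q : setpart m) :
  partition (tens_blocks (val P) (val Q)) [set: label (k + m)].
Proof.
case: P Q => [P pP] [Q pQ] /=; apply: partition_setTI => [z|A B z|].
- case: (@labelP k m z) => {}z; [have [A AP zA] := partition_setT_cover z pP
                       |have [A AP zA] := partition_setT_cover z pQ].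
    exists (@labelL k m @: A); last exact: imset_f.
    by apply/setUP; left; apply: (imset_f (fun B : {set label k} => _ @: B)).
  exists (@labelR k m @: A); last exact: imset_f.
  by apply/setUP; right; apply: (imset_f (fun B : {set label m} => _ @: B)).
- rewrite !inE => /orP[]/imsetP[A' AP ->] /orP[]/imsetP[B' BP ->]
    /imsetP[x xA ->] /imsetP[y yB].
  + move=> /labelL_inj xy; subst y.
    by rewrite (partition_setT_eq pP AP BP xA yB).
  + by move/labelLR.
  + by move/esym/labelLR.
  + move=> /labelR_inj xy; subst y.
    by rewrite (partition_setT_eq pQ AP BP xA yB).
- rewrite !inE negb_or; apply/andP; split; apply/imsetP=> -[A AP] /esym/eqP.
    by rewrite imset_eq0 => /eqP A0; move: AP; rewrite A0 (partition0 pP).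
  by rewrite imset_eq0 => /eqP A0; move: AP; rewrite A0 (partition0 pQ).
Qed.

Definition tens_setpart k m (P : setpart k) (Q : setpart m) : setpart (k + m) :=
  SetPart (tens_blocksP P Q).

Definition merge_setpart k (P : setpart k) (x y : label k) : setpart k :=
  SetPart (merge_blocksP x y (valP P)).

Lemma empty_setpartP : partition set0 [set: label 0].
Proof.
have -> : [set: label 0] = set0 by apply/setP => -[] [].
by rewrite partition_set0.
Qed.

Definition empty_diagram : diagram := Diagram (SetPart empty_setpartP).

Definition tens (d e : diagram) : diagram :=
  Diagram (tens_setpart (tagged d) (tagged e)).

(* In orders k = k0 + 1 and m = m0 + 1, the label k' of d ⊗ e is [lshift] of   *)
(* the last ordinal of 'I_k, and the label (k + 1)' is [rshift] of the first   *)
(* ordinal of 'I_m.                                                            *)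
Definition bull (d e : diagram) : diagram :=
  match d, e with
  | existT 0 _, _ => e
  | _, existT 0 _ => d
  | existT k0.+1 P, existT m0.+1 Q =>
      Diagram (merge_setpart (tens_setpart P Q)
                 (inr (lshift m0.+1 (@ord_max k0)))
                 (inr (rshift k0.+1 (@ord0 m0))))
  end.

Lemma dorder_tens d e : dorder (tens d e) = (dorder d + dorder e)%N.
Proof. by []. Qed.

Lemma dorder_bull d e : dorder (bull d e) = (dorder d + dorder e)%N.
Proof. by case: d e => [[|k] P] [[|m] Q]; rewrite /dorder /= ?addn0. Qed.

Lemma dorder_eq0 d : (dorder d == 0%N) = (d == empty_diagram).
Proof.
apply/eqP/eqP=> [|->] //; case: d => k P; rewrite /dorder /= => k0; subst k.
congr existT; apply: val_inj => /=; apply/eqP.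
rewrite -partition_set0; have -> : set0 = [set: label 0]; last exact: valP P.
by apply/setP => -[] [].
Qed.

Inductive op := Tens | Bull.

Definition eval_op (o : op) : diagram -> diagram -> diagram :=
  match o with Tens => tens | Bull => bull end.

Definition irreducible_for (o : op) (d : diagram) : Prop :=
  ~ exists e f, [/\ e <> empty_diagram, f <> empty_diagram & d = eval_op o e f].

(* [(d1, [:: (o1, d2); (o2, d3); ...])] stands for d1 o1 d2 o2 d3 ...          *)
Definition expression : Type := diagram * seq (op * diagram).

(* Left-bracketed; ⊗ and • associate with each other on non-empty diagrams.    *)
Definition eval_expr (s : expression) : diagram :=
  foldl (fun d od => eval_op od.1 d od.2) s.1 s.2.

Definition factors (s : expression) : seq diagram := s.1 :: unzip2 s.2.

Definition tens_positions (s : expression) (i : nat) : Prop :=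
  (1 <= i <= size s.2)%N /\ (nth (Bull, empty_diagram) s.2 i.-1).1 = Tens.

Definition factorization (d : diagram) (s : expression) : Prop :=
  eval_expr s = d /\
  (forall f, f \in factors s ->
     [/\ f <> empty_diagram, irreducible_for Tens f & irreducible_for Bull f]).

(* [refines d e] is d <= e. The factorization of a non-empty diagram is unique,*)
(* so that s and t are determined by d and e; the empty diagram has none.      *)
Definition refines (d e : diagram) : Prop :=
  (d = empty_diagram /\ e = empty_diagram) \/
  exists s t, [/\ factorization d s, factorization e t, factors s = factors t
    & forall i, tens_positions t i -> tens_positions s i].

Lemma dorder_eval (s : expression) :
  dorder (eval_expr s) = (\sum_(d <- factors s) dorder d)%N.
Proof.
case: s => d s; rewrite /eval_expr /factors big_cons /=.
elim: s d => [|[o e] s IHs] d /=; first by rewrite big_nil addn0.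
by rewrite IHs big_cons /= addnA; case: o; rewrite /= ?dorder_bull.
Qed.

Lemma refines_dorder d e : refines d e -> dorder d = dorder e.
Proof.
case=> [[-> ->] //|[s [t [[<- _] [<- _] eq_st _]]]].
by rewrite !dorder_eval eq_st.
Qed.

Definition diagrams_of_order (k : nat) : seq diagram :=
  [seq Diagram P | P <- enum (setpart k)].

Definition diagrams_upto (n : nat) : seq diagram :=
  flatten [seq diagrams_of_order k | k <- iota 0 n.+1].

Definition diagram_pairs_upto (n : nat) : seq (diagram * diagram) :=
  [seq (d, e) | d <- diagrams_upto n, e <- diagrams_upto n].

Lemma mem_diagrams_of_order k d : (d \in diagrams_of_order k) = (dorder d == k).
Proof.
apply/mapP/eqP=> [[P _ ->] //|<-]; case: d => m P.
by exists P; rewrite ?mem_enum.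
Qed.

Lemma mem_diagrams_upto n d : (d \in diagrams_upto n) = (dorder d <= n)%N.
Proof.
apply/flatten_mapP/idP=> [[k]|le_dn].
  by rewrite mem_iota mem_diagrams_of_order => /andP[_ lt_kn] /eqP ->.
by exists (dorder d); rewrite ?mem_iota ?mem_diagrams_of_order.
Qed.

Lemma diagrams_upto_uniq n : uniq (diagrams_upto n).
Proof.
rewrite /diagrams_upto; move: (iota_uniq 0 n.+1).
elim: (iota 0 n.+1) => //= k s IHs /andP[ks us].
rewrite cat_uniq IHs // andbT; apply/andP; split.
  rewrite map_inj_uniq ?enum_uniq // => P Q eqPQ.
  by apply/eqP; rewrite -(@eq_Tagged _ setpart (Diagram P)) -/(Diagram Q) eqPQ.
apply/hasPn=> d /flatten_mapP[m ms]; rewrite mem_diagrams_of_order => /eqP dm.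
by rewrite /= mem_diagrams_of_order dm; apply: contraNN ks => /eqP <-.
Qed.

Lemma mem_diagram_pairs_upto n (p : diagram * diagram) :
  (p \in diagram_pairs_upto n) = (dorder p.1 <= n)%N && (dorder p.2 <= n)%N.
Proof.
case: p => d e; rewrite -!mem_diagrams_upto.
apply/allpairsP/andP=> [[[d' e'] /= [? ? [-> ->]]] //|[? ?]].
by exists (d, e).
Qed.

Lemma diagram_pairs_upto_uniq n : uniq (diagram_pairs_upto n).
Proof.
by apply: allpairs_uniq; rewrite ?diagrams_upto_uniq // => -[? ?] [? ?] _ _ [-> ->].
Qed.

Section ParQSym.
Variable K : fieldType.

Definition ParQSym : lmodType K := {malg K[diagram]}.

Definition Mpar (d : diagram) : ParQSym := << d >>.

(* ParQSym ⊗ ParQSym, realized as the free module on the pairs of diagrams:    *)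
(* << (d, e) >> is M_d ⊗ M_e.                                                  *)
Definition ParQSym2 : lmodType K := {malg K[(diagram * diagram)%type]}.

Definition otens (f g : ParQSym) : ParQSym2 :=
  \sum_(d <- msupp f) \sum_(e <- msupp g) (f@_d * g@_e) *: << (d, e) >>.

(* Pairs with d ⊗ e = s (or d • e = s) lie in the range, by [dorder_tens] (or  *)
(* [dorder_bull]).                                                             *)
Definition DeltaM (s : diagram) : ParQSym2 :=
  \sum_(p <- diagram_pairs_upto (dorder s) | tens p.1 p.2 == s)
     otens (Mpar p.1) (Mpar p.2).

Definition Delta (f : ParQSym) : ParQSym2 :=
  \sum_(s <- msupp f) f@_s *: DeltaM s.

(* [refines s d] forces [dorder s = dorder d], see [refines_dorder].            *)
Definition Lpar (d : diagram) : ParQSym :=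
  \sum_(s <- diagrams_upto (dorder d) | `[< refines s d >]) Mpar s.

End ParQSym.

(* Main.v *)
(* Both sides are compared at M_a ⊗ M_b. On the left the coefficient is 1 if
   a ⊗ b refines pi and 0 otherwise; on the right it is the number of pairs (p, q)
   with a <= p, b <= q and pi = p ⊗ q or pi = p • q. Since the orders of p and q
   are those of a and b, and a product of either kind determines its two factors
   once their orders are known, there is at most one such pair. It exists exactly
   when a ⊗ b <= pi: by uniqueness of factorizations the one of a ⊗ b is the
   concatenation of those of a and b, and that of pi can be cut at the same place,
   whichever operation stands there.

   Diagrams are handled through the relation "in the same block": in a product, its
   restriction to each factor is that of the factor, and two labels in different
   factors are related only for •, through the two labels that are merged. *)
Require Import Defs.
From mathcomp Require Import all_boot all_order all_algebra.
From mathcomp Require Import finmap boolp monalg.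
From mathcomp Require Import zify.

Set Implicit Arguments.
Unset Strict Implicit.

(** * The same-block relation of a set partition *)

Definition same_block k (P : setpart k) : rel (label k) :=
  fun x y => y \in pblock (val P) x.

Section SameBlock.
Variables (k : nat) (P : setpart k).

Lemma same_blockP x y :
  reflect (exists A, [/\ A \in val P, x \in A & y \in A]) (same_block P x y).
Proof.
have pP := valP P; have tP := partition_trivIset pP.
apply: (iffP idP) => [xy|[A [AP xA yA]]]; last by rewrite /same_block (def_pblock tP AP xA).
have xP : x \in cover (val P) by rewrite (cover_partition pP) inE.
by exists (pblock (val P) x); rewrite mem_pblock pblock_mem.
Qed.

Lemma same_block_refl x : same_block P x x.
Proof. by rewrite /same_block mem_pblock (cover_partition (valP P)) inE. Qed.

Lemma same_block_sym x y : same_block P x y = same_block P y x.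
Proof. by apply/same_blockP/same_blockP => -[A [? ? ?]]; exists A. Qed.

Lemma same_block_trans y x z : same_block P x y -> same_block P y z -> same_block P x z.
Proof.
move=> /same_blockP[A [AP xA yA]] /same_blockP[B [BP yB zB]].
by apply/same_blockP; exists A; split=> //; rewrite (partition_setT_eq (valP P) AP BP yA yB).
Qed.

End SameBlock.

Lemma same_block_merge k (P : setpart k) a b x y :
  same_block (merge_setpart P a b) x y =
  same_block P x y || (same_block P a x || same_block P b x)
                      && (same_block P a y || same_block P b y).
Proof.
have pP := valP P; have tP := partition_trivIset pP.
apply/same_blockP/idP => [[A []]|].
  rewrite /= in_setU1 => /orP[/eqP->|].
    by rewrite !inE => xA yA; apply/orP; right; apply/andP.
  by rewrite in_setD => /andP[_ AP] xA yA; apply/orP; left; apply/same_blockP; exists A.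
case/orP=> [xy|/andP[xab yab]]; last first.
  exists (pblock (val P) a :|: pblock (val P) b); rewrite in_setU1 eqxx.
  by split=> //; rewrite inE.
(* If [x] lies in one of the merged blocks, so does [y], and the union is the witness. Otherwise the
   block of [x] survives the merge. *)
have [xab|nxab] := boolP (same_block P a x || same_block P b x).
  exists (pblock (val P) a :|: pblock (val P) b); rewrite in_setU1 eqxx; split=> //.
    by rewrite inE.
  rewrite inE; case/orP: xab => ax; apply/orP; [left|right];
    exact: (same_block_trans ax xy).
exists (pblock (val P) x); split; [|exact: same_block_refl|exact: xy].
rewrite in_setU1 in_setD pblock_mem ?(cover_partition pP) ?inE // andbT negb_or.
apply/orP; right; move: nxab; rewrite negb_or => /andP[ax bx].
by apply/andP; split; apply/eqP => eq_x; [case/negP: ax|case/negP: bx];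
  rewrite /same_block -eq_x; apply: same_block_refl.
Qed.


Section SameBlockTens.
Variables (k m : nat) (P : setpart k) (Q : setpart m).

Lemma same_block_tensLL x y :
  same_block (tens_setpart P Q) (labelL m x) (labelL m y) = same_block P x y.
Proof.
apply/same_blockP/same_blockP => -[A [AP xA yA]]; last first.
  exists (@labelL k m @: A); rewrite !imset_f //; split=> //.
  by apply/setUP; left; apply: (imset_f (fun B : {set label k} => _ @: B)).
move: AP xA yA; rewrite inE => /orP[]/imsetP[B BP ->] /imsetP[u uB].
  move=> /labelL_inj-> /imsetP[v vB /labelL_inj->].
  by exists B.
by move/labelLR.
Qed.

Lemma same_block_tensRR x y :
  same_block (tens_setpart P Q) (labelR k x) (labelR k y) = same_block Q x y.
Proof.
apply/same_blockP/same_blockP => -[A [AP xA yA]]; last first.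
  exists (@labelR k m @: A); rewrite !imset_f //; split=> //.
  by apply/setUP; right; apply: (imset_f (fun B : {set label m} => _ @: B)).
move: AP xA yA; rewrite inE => /orP[]/imsetP[B BP ->] /imsetP[u uB].
  by move/esym/labelLR.
move=> /labelR_inj-> /imsetP[v vB /labelR_inj->].
by exists B.
Qed.

Lemma same_block_tensLR x y :
  same_block (tens_setpart P Q) (labelL m x) (labelR k y) = false.
Proof.
apply/same_blockP => -[A [AP xA yA]].
move: AP xA yA; rewrite inE => /orP[]/imsetP[B BP ->] /imsetP[u uB].
  by move=> _ /imsetP[v vB /esym/labelLR].
by move/labelLR.
Qed.

End SameBlockTens.

(** A partition is the set of classes of its own same-block relation. *)
Lemma setpart_ext k (P Q : setpart k) : same_block P =2 same_block Q -> P = Q.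
Proof.
move=> PQ; apply: val_inj.
rewrite -(equivalence_partition_pblock (valP P)) -(equivalence_partition_pblock (valP Q)).
by apply: eq_imset => x; apply/setP=> y; rewrite !inE; apply: PQ.
Qed.

(** * Blocks seen through labels coded in a common type *)

(* Labels of all orders are embedded in [bool * nat], with 0-based second
   component, so that no casts between ['I_(k + (l + m))] and ['I_(k + l + m)]
   are needed. *)
Definition code k (u : label k) : bool * nat :=
  match u with inl i => (false, val i) | inr i => (true, val i) end.

Definition shift k (x : bool * nat) : bool * nat := (x.1, k + x.2).

(** Codes beyond the order of [d] are linked to nothing, not even to themselves, so a link carries
    its own bounds ([linked_lt]). *)
Definition linked (d : diagram) : rel (bool * nat) := fun x y =>
  [exists u, exists v, [&& code u == x, code v == y & same_block (tagged d) u v]].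

Lemma code_inj k : injective (@code k).
Proof. by move=> [i|i] [j|j] [] // /val_inj ->. Qed.

Lemma code_lt k (u : label k) : (code u).2 < k.
Proof. by case: u => i /=. Qed.

Lemma codeP k x : x.2 < k -> exists u : label k, code u = x.
Proof.
by case: x => -[] i /= lt_ik; [exists (inr (Ordinal lt_ik))|exists (inl (Ordinal lt_ik))].
Qed.

Lemma code_labelL k m (u : label k) : code (labelL m u) = code u.
Proof. by case: u. Qed.

Lemma code_labelR k m (u : label m) : code (labelR k u) = shift k (code u).
Proof. by case: u. Qed.

Lemma linkedP d x y :
  reflect (exists u v, [/\ code u = x, code v = y & same_block (tagged d) u v])
          (linked d x y).
Proof.
apply: (iffP existsP) => [[u /existsP[v /and3P[/eqP ? /eqP ? ?]]]|[u [v [<- <- uv]]]].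
  by exists u, v.
by exists u; apply/existsP; exists v; rewrite !eqxx.
Qed.

Lemma linked_code k (P : setpart k) u v :
  linked (Diagram P) (code u) (code v) = same_block P u v.
Proof.
apply/linkedP/idP => [[a [b []]] /code_inj-> /code_inj-> //|uv].
by exists u, v.
Qed.

Lemma linked_lt d x y : linked d x y -> (x.2 < dorder d) && (y.2 < dorder d).
Proof. by case/linkedP=> u [v [<- <- _]]; rewrite !code_lt. Qed.

Lemma linked_sym d x y : linked d x y = linked d y x.
Proof.
by apply/linkedP/linkedP => -[u [v [? ? ?]]]; exists v, u; rewrite same_block_sym.
Qed.

Lemma diagram_ext d e : dorder d = dorder e ->
  (forall x y, x.2 < dorder d -> y.2 < dorder d -> linked d x y = linked e x y) -> d = e.
Proof.
case: d e => [k P] [m Q]; rewrite /dorder /= => km; subst m => de.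
congr existT; apply: setpart_ext => u v.
by rewrite -!linked_code; apply: de; apply: code_lt.
Qed.

(** * Linked labels in a product *)

Definition first : bool * nat := (true, 0).
(** The code of k' for a diagram of order k > 0, as [first] is that of 1'. In order 0 the truncated
    predecessor gives a code out of range, where [linked] is false. *)
Definition final (d : diagram) : bool * nat := (true, (dorder d).-1).

Definition is_bull (o : op) : bool := if o is Bull then true else false.

Lemma dorder_op o d e : dorder (eval_op o d e) = dorder d + dorder e.
Proof. by case: o; rewrite /= ?dorder_tens ?dorder_bull. Qed.

Lemma shift0 x : shift 0 x = x.
Proof. by case: x. Qed.

Lemma bull0d d e : dorder d = 0 -> bull d e = e.
Proof. by case: d => [[]]. Qed.

Lemma bulld0 d e : dorder e = 0 -> bull d e = d.
Proof.
move=> e0; case: d => [[|k] P]; last by case: e e0 => [[]].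
by move/eqP: e0; rewrite bull0d // dorder_eq0 => /eqP->; apply/esym/eqP; rewrite -dorder_eq0.
Qed.

(** Convertible to the partition in [bull], but with the merged labels written through [labelL] and
    [labelR], so that the [same_block_tens] lemmas rewrite them. *)
Definition bull_setpart k m (P : setpart k.+1) (Q : setpart m.+1) :=
  merge_setpart (tens_setpart P Q)
    (labelL m.+1 (inr ord_max)) (labelR k.+1 (inr ord0)).

Lemma bullSS k m (P : setpart k.+1) (Q : setpart m.+1) :
  bull (Diagram P) (Diagram Q) = Diagram (bull_setpart P Q).
Proof. by []. Qed.

Section BullSetpart.
Variables (k m : nat) (P : setpart k.+1) (Q : setpart m.+1).

(** Merging adds no pair inside a factor: two left labels of the merged block both lie in the block
    of [ord_max], hence were already together. *)
Lemma same_block_bullLL x y :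
  same_block (bull_setpart P Q) (labelL m.+1 x) (labelL m.+1 y) = same_block P x y.
Proof.
rewrite same_block_merge ![same_block _ (labelR _ _) _]same_block_sym.
rewrite !same_block_tensLL !same_block_tensLR !orbF.
apply/orb_idr => /andP[ax ay]; apply: same_block_trans ay.
by rewrite same_block_sym.
Qed.

Lemma same_block_bullRR x y :
  same_block (bull_setpart P Q) (labelR k.+1 x) (labelR k.+1 y) = same_block Q x y.
Proof.
rewrite same_block_merge !same_block_tensRR !same_block_tensLR.
apply/orb_idr => /andP[ax ay]; apply: same_block_trans ay.
by rewrite same_block_sym.
Qed.

Lemma same_block_bullLR x y :
  same_block (bull_setpart P Q) (labelL m.+1 x) (labelR k.+1 y) =
  same_block P x (inr ord_max) && same_block Q (inr ord0) y.
Proof.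
rewrite same_block_merge [same_block _ (labelR _ _) (labelL _ _)]same_block_sym.
rewrite !same_block_tensLL !same_block_tensRR !same_block_tensLR orbF /=.
by rewrite [same_block P _ _]same_block_sym.
Qed.

End BullSetpart.

Section LinkedOp.
Variables (o : op) (d e : diagram).

Lemma linked_opLL x y : x.2 < dorder d -> y.2 < dorder d ->
  linked (eval_op o d e) x y = linked d x y.
Proof.
case: o => /= [|lt_x lt_y].
  case: d e => [k P] [m Q] /codeP[u <-] /codeP[v <-].
  rewrite -[LHS]/(linked (Diagram (tens_setpart P Q)) _ _).
  by rewrite linked_code -(code_labelL m u) -(code_labelL m v) linked_code same_block_tensLL.
have [e0|e_gt0] := posnP (dorder e); first by rewrite bulld0.
case: d e lt_x lt_y e_gt0 => [[|k] P] [[|m] Q] // /codeP[u <-] /codeP[v <-] _.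
by rewrite bullSS linked_code -(code_labelL m.+1 u) -(code_labelL m.+1 v)
  linked_code same_block_bullLL.
Qed.

Lemma linked_opRR x y :
  linked (eval_op o d e) (shift (dorder d) x) (shift (dorder d) y) = linked e x y.
Proof.
have [|nlt_xy] := boolP ((x.2 < dorder e) && (y.2 < dorder e)); last first.
  apply/idP/idP => /linked_lt; last by rewrite (negbTE nlt_xy).
  by rewrite dorder_op !ltn_add2l (negbTE nlt_xy).
case/andP; case: o => /= [|lt_x lt_y].
  case: d e => [k P] [m Q] /codeP[u <-] /codeP[v <-].
  rewrite -[LHS]/(linked (Diagram (tens_setpart P Q)) _ _).
  by rewrite linked_code -(code_labelR _ u) -(code_labelR _ v) linked_code same_block_tensRR.
have [d0|d_gt0] := posnP (dorder d); first by rewrite bull0d // d0 !shift0.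
case: d e lt_x lt_y d_gt0 => [[|k] P] [[|m] Q] // /codeP[u <-] /codeP[v <-] _.
by rewrite bullSS linked_code -(code_labelR _ u) -(code_labelR _ v)
  linked_code same_block_bullRR.
Qed.

(** The only place where the two operations differ: a link across the cut must pass through the two
    merged labels. *)
Lemma linked_opLR x y : x.2 < dorder d ->
  linked (eval_op o d e) x (shift (dorder d) y) =
    [&& is_bull o, linked d x (final d) & linked e first y].
Proof.
move=> lt_x; case: (boolP (y.2 < dorder e)) => [lt_y|nlt_y]; last first.
  transitivity false; last first.
    by apply/esym/and3P => -[_ _ /linked_lt/andP[_]]; apply/negP.
  by apply: contraNF nlt_y => /linked_lt; rewrite dorder_op ltn_add2l => /andP[].
case: o => /=.
  case: d e lt_x lt_y => [k P] [m Q] /codeP[u <-] /codeP[v <-].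
  rewrite -[LHS]/(linked (Diagram (tens_setpart P Q)) _ _).
  by rewrite -(code_labelL m u) -(code_labelR _ v) linked_code same_block_tensLR.
(* Labels in range make both orders positive, so [bull] computes to a merge. *)
case: d e lt_x lt_y => [[|k] P] [[|m] Q] // /codeP[u <-] /codeP[v <-].
rewrite bullSS -[final _]/(code (inr ord_max : label k.+1)).
rewrite -[first]/(code (inr ord0 : label m.+1)) !linked_code.
by rewrite -(code_labelL m.+1 u) -(code_labelR _ v) linked_code same_block_bullLR.
Qed.

End LinkedOp.

(** * Associativity, cancellation and overlap of products *)

Lemma linked_refl d x : x.2 < dorder d -> linked d x x.
Proof.
by case: d => k P /codeP[u <-]; rewrite linked_code same_block_refl.
Qed.

Lemma shift_shift k m x : shift k (shift m x) = shift (k + m) x.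
Proof. by rewrite /shift /= addnA. Qed.

Lemma shiftP k x : k <= x.2 -> exists y, x = shift k y.
Proof. by case: x => b i /= ki; exists (b, i - k); rewrite /shift /= subnKC. Qed.

Lemma diagram_ext_split k d e : dorder d = dorder e ->
  (forall x y, x.2 < k -> y.2 < k -> linked d x y = linked e x y) ->
  (forall x y, linked d (shift k x) (shift k y) = linked e (shift k x) (shift k y)) ->
  (forall x y, x.2 < k -> linked d x (shift k y) = linked e x (shift k y)) ->
  d = e.
Proof.
move=> eq_de LL RR LR; apply: diagram_ext => // x y _ _.
have [xk|/shiftP[x' ->]] := ltnP x.2 k; have [yk|/shiftP[y' ->]] := ltnP y.2 k => //.
- exact: LL.
- exact: LR.
- by rewrite linked_sym LR // linked_sym.
Qed.

Lemma final_op o d e : 0 < dorder e ->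
  final (eval_op o d e) = shift (dorder d) (final e).
Proof. by rewrite /final /shift dorder_op /=; case: (dorder e) => // n _; rewrite addnS. Qed.

(** With [b] empty the sides would be [eval_op o2 a c] and [eval_op o1 a c]. With [b] non-empty, a
    link from [a] to [c] requires on either side both merges and a link in [b] between [first] and
    [final b]. *)
Lemma eval_opA o1 o2 a b c : 0 < dorder b ->
  eval_op o2 (eval_op o1 a b) c = eval_op o1 a (eval_op o2 b c).
Proof.
move=> b_gt0; apply: (@diagram_ext_split (dorder a)) => [|x y xa ya|x y|x y xa].
- by rewrite !dorder_op addnA.
- by rewrite !linked_opLL ?dorder_op // ltn_addr.
- have ltb z : z.2 < dorder b -> (shift (dorder a) z).2 < dorder (eval_op o1 a b).
    by rewrite dorder_op ltn_add2l.
  rewrite linked_opRR.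
  (* By symmetry, the case of [x] in [c] and [y] in [b] can be excluded. *)
  wlog le_xy : x y / x.2 < dorder b \/ dorder b <= y.2 => [IH|].
    have [xb|xb] := ltnP x.2 (dorder b); first by apply: IH; left.
    have [yb|yb] := ltnP y.2 (dorder b); last by apply: IH; right.
    by rewrite linked_sym [RHS]linked_sym; apply: IH; left.
  have [xb|xb] := ltnP x.2 (dorder b); have [yb|yb] := ltnP y.2 (dorder b).
  + by rewrite linked_opLL ?ltb // linked_opRR linked_opLL.
  + have [z ->] := shiftP yb.
    rewrite shift_shift -(dorder_op o1) linked_opLR ?ltb // linked_opLR //.
    by rewrite final_op // linked_opRR.
  + by move: le_xy; rewrite ltnNge xb leqNgt yb => -[].
  + have [z ->] := shiftP xb; have [t ->] := shiftP yb.
    by rewrite !shift_shift -(dorder_op o1) !linked_opRR.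
- rewrite [RHS]linked_opLR //.
  have xab : x.2 < dorder (eval_op o1 a b) by rewrite dorder_op ltn_addr.
  have [yb|yb] := ltnP y.2 (dorder b).
    have yab : (shift (dorder a) y).2 < dorder (eval_op o1 a b).
      by rewrite dorder_op ltn_add2l.
    by rewrite linked_opLL // linked_opLR // [linked (eval_op o2 b c) _ _]linked_opLL.
  have [z ->] := shiftP yb.
  rewrite shift_shift -(dorder_op o1) !linked_opLR // final_op // linked_opLR //.
  by case: (is_bull o1); rewrite ?andbF //= -!andbA andbCA.
Qed.

(** Whatever the operations, the factors are the traces of the product on its first labels and on
    the remaining ones. *)
Lemma eval_op_inj o o' a b c d : eval_op o a b = eval_op o' c d ->
  dorder a = dorder c -> a = c /\ b = d.
Proof.
move=> eq_op ac; have := congr1 dorder eq_op.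
rewrite !dorder_op ac => /addnI bd; split; apply: diagram_ext => // x y xa ya.
  by rewrite -(linked_opLL o b) // eq_op linked_opLL // -ac.
by rewrite -(linked_opRR o a) eq_op ac linked_opRR.
Qed.

Lemma eval_op_inj_op o o' a b : 0 < dorder a -> 0 < dorder b ->
  eval_op o a b = eval_op o' a b -> o = o'.
Proof.
(* The two labels that • merges are linked for • and not for ⊗. *)
move=> a0 b0 /(congr1 (fun d => linked d (final a) (shift (dorder a) first))).
have fin_lt : (final a).2 < dorder a by rewrite /final /= prednK.
rewrite !linked_opLR // !linked_refl // !andbT.
by case: o o' => -[].
Qed.

Lemma restrict_diagram k m d : dorder d = k + m ->
  exists2 e, dorder e = m &
    forall x y, x.2 < m -> y.2 < m -> linked e x y = linked d (shift k x) (shift k y).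
Proof.
case: d => n P; rewrite /dorder /= => eq_n; subst n.
(* The non-empty traces of the blocks are the fibres of the map sending a label to its block. *)
have part_f := preim_partitionP
  (fun u : label m => pblock (val P) (labelR k u)) [set: label m].
exists (Diagram (SetPart part_f)) => // x y /codeP[u <-] /codeP[v <-].
rewrite -(code_labelR k u) -(code_labelR k v) !linked_code /same_block /=.
rewrite pblock_equivalence_partition ?inE //; last by split=> // /eqP->.
by rewrite eq_pblock ?(partition_trivIset (valP P)) ?(cover_partition (valP P)) ?inE.
Qed.

(** The witness [t] is the part of [a] beyond the order of [b]. The cut between [t] and [f] is the
    one between [a] and [f], hence carries the same operation [o]. *)
Lemma eval_op_overlap o o' a f b g : eval_op o a f = eval_op o' b g ->
  dorder b < dorder a -> exists2 t, 0 < dorder t & g = eval_op o t f.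
Proof.
move=> eq_op lt_ba.
have [t t_ord tE] := restrict_diagram (esym (subnKC (ltnW lt_ba))).
have t_gt0 : 0 < dorder t by rewrite t_ord subn_gt0.
have ord_a : dorder a = dorder b + dorder t by rewrite t_ord subnKC // ltnW.
have lt_t z : z.2 < dorder t -> (shift (dorder b) z).2 < dorder a.
  by rewrite ord_a ltn_add2l.
have gE x y : linked g x y = linked (eval_op o a f) (shift (dorder b) x) (shift (dorder b) y).
  by rewrite eq_op linked_opRR.
have tE' x y : x.2 < dorder t -> y.2 < dorder t ->
  linked t x y = linked a (shift (dorder b) x) (shift (dorder b) y).
  by rewrite t_ord; apply: tE.
exists t => //; apply: (@diagram_ext_split (dorder t)) => [|x y xt yt|x y|x y xt].
- have := congr1 dorder eq_op; rewrite !dorder_op ord_a -addnA => /addnI.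
  by move->.
- by rewrite gE !linked_opLL ?lt_t // tE'.
- by rewrite gE !shift_shift -ord_a !linked_opRR.
- rewrite gE shift_shift -ord_a !linked_opLR ?lt_t // tE' //; last first.
    by rewrite /final /= prednK.
  (* As [t] is non-empty, the last label of [a] is the shifted last label of [t]. *)
  congr [&& _, linked a _ _ & _]; rewrite /final /shift /= ord_a.
  by case: (dorder t) t_gt0 => // n _; rewrite addnS.
Qed.

(** * Existence and uniqueness of factorizations *)

Definition indecomposable (d : diagram) : Prop :=
  [/\ d <> empty_diagram, irreducible_for Tens d & irreducible_for Bull d].

Lemma dorder_gt0 d : reflect (d <> empty_diagram) (0 < dorder d).
Proof. by rewrite lt0n dorder_eq0; apply: (iffP negP) => d0 /eqP. Qed.

Lemma eval_op_neq0 o d e : d <> empty_diagram -> eval_op o d e <> empty_diagram.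
Proof. by move/dorder_gt0 => d0; apply/dorder_gt0; rewrite dorder_op addn_gt0 d0. Qed.

Lemma indecomposable_op o d e :
  d <> empty_diagram -> e <> empty_diagram -> ~ indecomposable (eval_op o d e).
Proof.
move=> d0 e0 [_ irrT irrB].
by case: o irrT irrB => irrT irrB; [apply: irrT|apply: irrB]; exists d, e.
Qed.

Lemma eval_expr_rcons x l o f :
  eval_expr (x, rcons l (o, f)) = eval_op o (eval_expr (x, l)) f.
Proof. by rewrite /eval_expr /= foldl_rcons. Qed.

Lemma factorization_rcons d x l o f : factorization d (x, rcons l (o, f)) ->
  [/\ d = eval_op o (eval_expr (x, l)) f, factorization (eval_expr (x, l)) (x, l)
    & indecomposable f].
Proof.
rewrite /factorization eval_expr_rcons /factors /= /unzip2 map_rcons => -[<- irr].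
split=> //; last by apply: irr; rewrite inE mem_rcons mem_head orbT.
split=> // g gl; apply: irr; move: gl; rewrite !inE mem_rcons inE.
by case/orP=> ->; rewrite ?orbT.
Qed.

Lemma factorization_neq0 d s : factorization d s -> d <> empty_diagram.
Proof.
case=> <- irr; apply/dorder_gt0; rewrite dorder_eval /factors big_cons addn_gt0.
by case: (irr s.1 (mem_head _ _)) => /dorder_gt0->.
Qed.

(* Of two expressions of the same diagram, the one whose last factor is the
   shorter exhibits, by [eval_op_overlap], a decomposition of the last factor of
   the other. *)
Lemma factorization_unique d s t : factorization d s -> factorization d t -> s = t.
Proof.
case: s t => x l [y r]; elim/last_ind: l d r => [|l [o f] IHl] d r.
  case/lastP: r => [|r [o g]] [dE irr].
    by case=> yE _; move: dE; rewrite -yE /eval_expr /= => ->.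
  rewrite -{}dE => /factorization_rcons[dE fr irr_g].
  have := irr x (mem_head _ _); rewrite -/(indecomposable x).
  (* One expression has a single factor and the other at least two: the single factor would be a
     product. *)
  rewrite [x](_ : _ = eval_op o (eval_expr (y, r)) g) //.
  by move/indecomposable_op; case; [exact: factorization_neq0 fr|case: irr_g].
case/lastP: r => [|r [o' g]] /factorization_rcons[-> fl irr_f].
  case=> /= yE irr; have := irr y (mem_head _ _); rewrite -/(indecomposable y).
  rewrite [y](_ : _ = eval_op o (eval_expr (x, l)) f) //.
  by move/indecomposable_op; case; [exact: factorization_neq0 fl|case: irr_f].
case/factorization_rcons => eq_op fr irr_g.
have f0 : f <> empty_diagram by case: irr_f.
have g0 : g <> empty_diagram by case: irr_g.
have [lt|lt|eq_ord] := ltngtP (dorder (eval_expr (x, l))) (dorder (eval_expr (y, r))).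
- have [t /dorder_gt0 t0 fE] := eval_op_overlap (esym eq_op) lt.
  by case: (@indecomposable_op o' t g) => //; rewrite -fE.
- have [t /dorder_gt0 t0 gE] := eval_op_overlap eq_op lt.
  by case: (@indecomposable_op o t f) => //; rewrite -gE.
(* With prefixes of equal order, cancellation identifies the prefixes and the last factors, then the
   operations between them. *)
have [eq_lr eq_fg] := eval_op_inj eq_op eq_ord.
rewrite -eq_lr -eq_fg in eq_op fr.
have := eval_op_inj_op _ _ eq_op; rewrite -eq_fg => ->; last 2 first.
- by apply/dorder_gt0; apply: factorization_neq0 fl.
- exact/dorder_gt0.
by have [-> ->] := IHl _ _ fl fr.
Qed.

Definition join (s : expression) (o : op) (t : expression) : expression :=
  (s.1, s.2 ++ (o, t.1) :: t.2).

(** Evaluation brackets to the left, so the factors of [t] are regrouped one at a time by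
    [eval_opA]. The middle term there begins with [t.1], hence is non-empty. *)
Lemma eval_join s o t : t.1 <> empty_diagram ->
  eval_expr (join s o t) = eval_op o (eval_expr s) (eval_expr t).
Proof.
case: s t => x l [y r] /= y0; rewrite /eval_expr /= foldl_cat /=.
move: (foldl _ x l) => d; elim: r y y0 => [|[o' z] r IHr] y y0 //=.
rewrite eval_opA; last exact/dorder_gt0.
by apply: IHr; apply: eval_op_neq0.
Qed.

Lemma factors_join s o t : factors (join s o t) = factors s ++ factors t.
Proof. by rewrite /factors /= /unzip2 map_cat. Qed.

Lemma factorization_join o d e s t : factorization d s -> factorization e t ->
  factorization (eval_op o d e) (join s o t).
Proof.
move=> [<- irr_s] [<- irr_t]; split.
  by rewrite eval_join //; case: (irr_t t.1 (mem_head _ _)).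
by move=> f; rewrite factors_join mem_cat => /orP[/irr_s|/irr_t].
Qed.

Lemma factorization_joinE d s o t : factorization d (join s o t) ->
  [/\ d = eval_op o (eval_expr s) (eval_expr t), factorization (eval_expr s) s
    & factorization (eval_expr t) t].
Proof.
case=> <- irr; split.
- rewrite eval_join //; case: (irr t.1) => //.
  by rewrite factors_join mem_cat mem_head orbT.
- by split=> // f fs; apply: irr; rewrite factors_join mem_cat fs.
- by split=> // f ft; apply: irr; rewrite factors_join mem_cat ft orbT.
Qed.

Lemma factorization_exists d : d <> empty_diagram -> exists s, factorization d s.
Proof.
have [n] := ubnP (dorder d); elim: n d => // n IHn d lt_dn d0.
have [irr|] := pselect (indecomposable d).
  by exists (d, [::]); split=> // f; rewrite inE => /eqP->.
move=> red; suff [o [e [f [e0 f0 dE]]]] : exists o e f,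
    [/\ e <> empty_diagram, f <> empty_diagram & d = eval_op o e f].
  move: lt_dn (e0) (f0); rewrite dE dorder_op => lt_dn /dorder_gt0 e_gt0 /dorder_gt0 f_gt0.
  have [|s fs] := IHn e _ e0; first by lia.
  have [|t ft] := IHn f _ f0; first by lia.
  by exists (join s o t); apply: factorization_join.
have [[e [f ?]]|irrT] := pselect (exists e f,
    [/\ e <> empty_diagram, f <> empty_diagram & d = eval_op Tens e f]).
  by exists Tens, e, f.
have [[e [f ?]]|irrB] := pselect (exists e f,
    [/\ e <> empty_diagram, f <> empty_diagram & d = eval_op Bull e f]).
  by exists Bull, e, f.
by case: red.
Qed.

(** * Cutting factorizations and refining products *)

Lemma factors_joinP s o s' u : factors (join s o s') = factors u ->
  exists t o' t', [/\ u = join t o' t', factors s = factors t & factors s' = factors t'].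
Proof.
case: s s' u => [x l] [x' l'] [y r]; rewrite factors_join /factors /= => -[<-].
elim: l r x => [|[o1 z] l IHl] [|[o2 w] r] x //= [<-].
  by move=> lr; exists (x, [::]), o2, (x', r); rewrite lr.
case/(IHl _ z) => t [o' [t' [[-> ->] [eq_l] eq_l']]].
by exists (x, (o2, t.1) :: t.2), o', t'; rewrite /factors /= eq_l eq_l'.
Qed.

Lemma tens_positions_joinL s o t i : i <= size s.2 ->
  tens_positions (join s o t) i <-> tens_positions s i.
Proof.
rewrite /tens_positions /= size_cat nth_cat.
case: i => [|i] /= le_is; first by split=> -[].
by rewrite le_is /=; split=> -[_ nthE]; split=> //; lia.
Qed.

(** Positions count from 1 and [s] has [(size s.2).+1] factors, so the joining operation stands at
    this position. *)
Lemma tens_positions_join_op s o t :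
  tens_positions (join s o t) (size s.2).+1 <-> o = Tens.
Proof.
rewrite /tens_positions /= size_cat nth_cat ltnn subnn /=.
by split=> [[]|->] //; split=> //; lia.
Qed.

(** Stated for [i.+1], because 0 is no position of [t] while its shift is the position of the
    joining operation. *)
Lemma tens_positions_joinR s o t i :
  tens_positions (join s o t) ((size s.2).+1 + i.+1) <-> tens_positions t i.+1.
Proof.
rewrite /tens_positions /= size_cat nth_cat addSn addnS /=.
have -> : ((size s.2 + i).+1 < size s.2) = false by lia.
have -> : (size s.2 + i).+1 - size s.2 = i.+1 by lia.
by split=> -[? ?]; split=> //=; lia.
Qed.

Lemma size_factors s t : factors s = factors t -> size s.2 = size t.2.
Proof. by move/(congr1 size); rewrite /= !size_map => -[]. Qed.

(** Left parts of equal size put both cuts at the same position, so the inclusion splits into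
    positions before, at and after the cut. *)
Lemma tens_positions_join s o s' t o' t' : size s.2 = size t.2 ->
  (forall i, tens_positions (join t o' t') i -> tens_positions (join s o s') i) <->
  [/\ forall i, tens_positions t i -> tens_positions s i,
      o' = Tens -> o = Tens
    & forall i, tens_positions t' i -> tens_positions s' i].
Proof.
move=> eq_sz; split=> [sub|[sub sub_op sub'] i].
  split=> [i ti||[|i] ti]; last 2 first.
  - by case: ti.
  - by apply/(tens_positions_joinR s o)/sub; rewrite eq_sz; apply/tens_positions_joinR.
  - have le_it : i <= size t.2 by case: ti => /andP[].
    by apply/(tens_positions_joinL o s'); rewrite ?eq_sz //; apply/sub/tens_positions_joinL.
  - move=> o'T; apply/(tens_positions_join_op s o s'); rewrite eq_sz.
    by apply/sub/tens_positions_join_op.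
have [le_it|] := leqP i (size t.2).
  move/(tens_positions_joinL _ _ le_it)/sub.
  by rewrite -eq_sz in le_it => ?; apply/tens_positions_joinL.
move/subnKC <-; case: (i - _) => [|j].
  by rewrite addn0 -{2}eq_sz => /tens_positions_join_op/sub_op ?; apply/tens_positions_join_op.
by rewrite -{2}eq_sz => /tens_positions_joinR/sub' ?; apply/tens_positions_joinR.
Qed.

Lemma refines_emptyl d : refines empty_diagram d <-> d = empty_diagram.
Proof.
split=> [/refines_dorder/esym d0|->]; last by left.
by apply/eqP; rewrite -dorder_eq0 d0.
Qed.

Lemma refinesP d e : d <> empty_diagram -> refines d e ->
  exists s t, [/\ factorization d s, factorization e t, factors s = factors t
    & forall i, tens_positions t i -> tens_positions s i].
Proof. by move=> d0 [[]|]. Qed.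

(** The finer expression has ⊗ at the cut, so the condition there holds for either [o]. *)
Lemma refines_op a b p q o :
  refines a p -> refines b q -> a <> empty_diagram -> b <> empty_diagram ->
  refines (tens a b) (eval_op o p q).
Proof.
move=> ap bq /refinesP/(_ ap)[s [t [fs ft st sub]]].
move=> /refinesP/(_ bq)[s' [t' [fs' ft' st' sub']]].
right; exists (join s Tens s'), (join t o t'); split.
- exact: (@factorization_join Tens).
- exact: factorization_join.
- by rewrite !factors_join st st'.
- by apply/tens_positions_join; rewrite ?(size_factors st).
Qed.

Lemma refines_tens a b pi :
  a <> empty_diagram -> b <> empty_diagram -> refines (tens a b) pi ->
  exists p q o, [/\ refines a p, refines b q & eval_op o p q = pi].
Proof.
move=> a0 b0 /refinesP[]; first exact: (@eval_op_neq0 Tens).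
move=> u [v [fu fv uv sub]].
have [s fs] := factorization_exists a0; have [s' fs'] := factorization_exists b0.
have uE := factorization_unique fu (@factorization_join Tens _ _ _ _ fs fs').
rewrite {}uE in uv sub {fu}.
have [t [o [t' [vE st st']]]] := factors_joinP uv.
rewrite {}vE in sub fv {uv}; have [-> ft ft'] := factorization_joinE fv.
have [sub_t _ sub_t'] := (tens_positions_join _ _ _ _ (size_factors st)).1 sub.
by exists (eval_expr t), (eval_expr t'), o; split=> //; right; [exists s, t|exists s', t'].
Qed.

Lemma eval_op0d o d : eval_op o empty_diagram d = d.
Proof.
(* Cut at 0, only the pairs on the right of the cut remain. *)
apply: (@diagram_ext_split 0) => [|//|x y|//]; first by rewrite dorder_op.
by rewrite [LHS](linked_opRR o empty_diagram) !shift0.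
Qed.

Lemma eval_opd0 o d : eval_op o d empty_diagram = d.
Proof.
have ord : dorder (eval_op o d empty_diagram) = dorder d by rewrite dorder_op addn0.
by apply: diagram_ext => //; rewrite ord => x y xd yd; rewrite linked_opLL.
Qed.

(** Empty diagrams have no factorization and are treated apart: if [a] or [b] is empty, so is the
    corresponding [p] or [q]. *)
Lemma refines_tensP a b pi :
  refines (tens a b) pi <->
  exists p q o, [/\ refines a p, refines b q & eval_op o p q = pi].
Proof.
have [->|/eqP a0] := eqVneq a empty_diagram.
  rewrite [tens _ _](eval_op0d Tens); split=> [ref_b|[p [q [o [/refines_emptyl-> ref_b <-]]]]].
    by exists empty_diagram, pi, Tens; split; rewrite ?eval_op0d //; left.
  by rewrite eval_op0d.
have [->|/eqP b0] := eqVneq b empty_diagram.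
  rewrite [tens _ _](eval_opd0 Tens); split=> [ref_a|[p [q [o [ref_a /refines_emptyl-> <-]]]]].
    by exists pi, empty_diagram, Tens; split; rewrite ?eval_opd0 //; left.
  by rewrite eval_opd0.
split=> [/refines_tens|[p [q [o [ap bq <-]]]]]; first exact.
exact: refines_op.
Qed.

(** * Coefficients and the coproduct formula *)

Import GRing.Theory.
Local Open Scope ring_scope.

(** Reads a coefficient off a sum over a finite list, whether or not the index [j] is enumerated
    there. *)
Lemma sum_seq_delta (R : nmodType) (I : eqType) (r : seq I) (F : I -> R) j :
  uniq r -> (j \notin r -> F j = 0) -> \sum_(i <- r) F i *+ (i == j) = F j.
Proof.
move=> ur Fj; have [jr|/[dup] jr /Fj->] := boolP (j \in r).
  by rewrite (bigD1_seq j) //= eqxx big1 => [|i /negbTE-> //]; rewrite addr0.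
rewrite big_seq big1 // => i ir; have [eq_ij|//] := eqVneq i j.
by rewrite -eq_ij ir in jr.
Qed.

Section Coefficients.
Variable K : fieldType.

Lemma mcoeff_Lpar d s : (Lpar K d)@_s = (`[< refines s d >])%:R.
Proof.
rewrite /Lpar raddf_sum /= big_mkcond /=.
rewrite (eq_bigr (fun t => (`[< refines t d >])%:R *+ (t == s))) => [|t _]; last first.
  by rewrite /Mpar mcoeffU; case: asboolP; rewrite ?mul0rn.
apply: (sum_seq_delta (F := fun t => (`[< refines t d >])%:R));
  first exact: diagrams_upto_uniq.
rewrite mem_diagrams_upto; case: asboolP => // /refines_dorder->.
by rewrite leqnn.
Qed.

Lemma mcoeff_otens (f g : ParQSym K) p : (otens f g)@_p = f@_p.1 * g@_p.2.
Proof.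
case: p => a b /=; rewrite /otens raddf_sum /=.
rewrite (eq_bigr (fun d => f@_d * g@_b *+ (d == a))) => [|d _].
  apply: (sum_seq_delta (F := fun d => f@_d * g@_b)) => // /mcoeff_outdom ->.
  by rewrite mul0r.
rewrite raddf_sum /= (eq_bigr (fun e => (f@_d * g@_e *+ (d == a)) *+ (e == b))) => [|e _].
  apply: (sum_seq_delta (F := fun e => f@_d * g@_e *+ (d == a))) => // /mcoeff_outdom ->.
  by rewrite mulr0 mul0rn.
by rewrite mcoeffZ mcoeffU mulr_natr xpair_eqE -mulrnA mulnb.
Qed.

Lemma mcoeff_DeltaM s p : (DeltaM K s)@_p = (tens p.1 p.2 == s)%:R.
Proof.
rewrite /DeltaM raddf_sum /= big_mkcond /=.
rewrite (eq_bigr (fun q => (tens q.1 q.2 == s)%:R *+ (q == p))) => [|q _]; last first.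
  case: eqP => _; rewrite ?mul0rn //.
  rewrite mcoeff_otens /Mpar !mcoeffU -natrM mulnb -[RHS]/((q == p)%:R).
  by case: q p => [? ?] [? ?]; rewrite xpair_eqE.
apply: (sum_seq_delta (F := fun q => (tens q.1 q.2 == s)%:R)).
  exact: diagram_pairs_upto_uniq.
rewrite mem_diagram_pairs_upto; case: eqP => // <-.
by rewrite dorder_tens leq_addr leq_addl.
Qed.

(** A pair of diagrams occurs in the coproduct of exactly one basis element, that of their
    ⊗-product. *)
Lemma mcoeff_Delta (f : ParQSym K) p : (Delta f)@_p = f@_(tens p.1 p.2).
Proof.
rewrite /Delta raddf_sum /= (eq_bigr (fun s => f@_s *+ (s == tens p.1 p.2))) => [|s _].
  by apply: (sum_seq_delta (F := fun s => f@_s)) => // /mcoeff_outdom.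
by rewrite mcoeffZ mcoeff_DeltaM mulr_natr eq_sym.
Qed.

End Coefficients.

Theorem proposition4p2 (K : fieldType) (pi : diagram) :
  Delta (Lpar K pi) =
    \sum_(p <- diagram_pairs_upto (dorder pi)
          | (tens p.1 p.2 == pi) || (bull p.1 p.2 == pi))
       otens (Lpar K p.1) (Lpar K p.2).
Proof.
apply/malgP => -[a b]; rewrite mcoeff_Delta mcoeff_Lpar raddf_sum /=.
under eq_bigr => p _ do rewrite mcoeff_otens !mcoeff_Lpar -natrM mulnb.
(* If [p] or [q] is empty, both operations may give [pi], but the pair is still a single summand;
   hence a mere existence of [o]. *)
have opP p q : reflect (exists o, eval_op o p q = pi)
    ((tens p q == pi) || (bull p q == pi)).
  apply: (iffP orP) => [[]/eqP<-|[[] /= ->]]; rewrite ?eqxx.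
  - by exists Tens.
  - by exists Bull.
  - by left.
  - by right.
case: asboolP => [/refines_tensP[p [q [o [ap bq eq_pq]]]]|nref]; last first.
  rewrite big1 // => -[p q] /= /opP[o eq_pq].
  case: asboolP => // ap; case: asboolP => // bq.
  by case: nref; apply/refines_tensP; exists p, q, o.
(* The pair [(p, q)] contributes 1, and it remains to see that every other pair contributes 0. *)
rewrite big_mkcond (bigD1_seq (p, q)) /=; last exact: diagram_pairs_upto_uniq; last first.
  by rewrite mem_diagram_pairs_upto -eq_pq dorder_op leq_addr leq_addl.
rewrite ifT; last by apply/opP; exists o.
rewrite !asboolT // big1 ?addr0 // => -[p' q'] neq.
case: ifP => // /opP[o' eq_pq']; case: asboolP => // ap'; case: asboolP => // bq'.
(* Both [p] and [p'] have the order of [a], so cancellation makes the two pairs equal. *)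
case/eqP: neq; rewrite /= -eq_pq in ap' bq' eq_pq' *.
by have [|-> ->] := eval_op_inj eq_pq'; rewrite -?(refines_dorder ap) -?(refines_dorder ap').
Qed.
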